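(* Suppose there is a polynomial-time exact algorithm for the FCMJ problem, i.e. an algorithm that, given any FCMJ instance, outputs an optimal solution $(q_c)_{c\in\mathcal{C}}$ in time polynomial in the size of the (binary-encoded) instance. Then there is a polynomial-time algorithm for integer factorization, i.e. an algorithm that computes the prime factorization of any given composite number $M$ in time polynomial in $\log M$.
   Context: Notation: $\mathbb{Z}_+$ denotes the set of positive integers, and $\operatorname{lcm}(S)$ is the least common multiple of a finite nonempty set $S\subseteq\mathbb{Z}_+$. **The FCMJ (Frequency-Constrained Maintenance Jobs) problem.** An instance consists of: a finite directed tree $T=(\mathcal{C}\cup\mathcal{M},\mathcal{E})$ with edges oriented away from a root (an arborescence), where the elements of $\mathcal{C}$ (components) are the leaves, the other nodes, forming $\mathcal{M}$, are called modules, and the root $r$ is a module, $r\in\mathcal{M}$; a cycle limit $f_c\in\mathbb{Z}_+$ for each component $c\in\mathcal{C}$; a setup cost $K_c$ for each component $c\in\mathcal{C}$; and a setup cost $K_m$ for each module $m\in\mathcal{M}$. Setup costs are nonnegative rational numbers, and all numbers are encoded in binary. For $m\in\mathcal{M}$, let $C_m\subseteq\mathcal{C}$ be the set of components that are children of $m$ in $T$. The problem is to find cycle times $q_c$, $c\in\mathcal{C}$, solving $$\min\ \sum_{c\in\mathcal{C}}\frac{K_c}{q_c}+\sum_{m\in\mathcal{M}}K_m\sum_{\emptyset\neq C\subseteq C_m}\frac{(-1)^{|C|+1}}{\operatorname{lcm}(\{q_c: c\in C\})}\quad\text{subject to } q_c\le f_c,\ q_c\in\mathbb{Z}_+\ \text{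 for all } c\in\mathcal{C}.$$ *)

(* Defs.v *)
From mathcomp Require Import all_boot all_order all_algebra.

Set Implicit Arguments.
Unset Strict Implicit.
Unset Printing Implicit Defensive.

Import Order.TTheory GRing.Theory Num.Theory.

(** * Polynomial time

    The machine model is the random access machine under the logarithmic cost
    criterion, with structured control flow.  It simulates, and is simulated by,
    multitape Turing machines with polynomial overhead. *)

Definition mem := nat -> nat.

Definition upd (m : mem) (a v : nat) : mem := fun b => if b == a then v else m b.

Inductive binop := Add | Sub | Mul | Div | Mod.

Definition binop_fun (o : binop) : nat -> nat -> nat :=
  match o with
  | Add => addn | Sub => subn | Mul => muln | Div => divn | Mod => modn
  end.

(* [Read e] is indirect addressing: the content of the cell whose address is
   the value of [e]. *)
Inductive expr :=
  | Const of nat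
  | Read of expr
  | Bin of binop & expr & expr.

Fixpoint eval (m : mem) (e : expr) : nat :=
  match e with
  | Const n => n
  | Read e1 => m (eval m e1)
  | Bin o e1 e2 => binop_fun o (eval m e1) (eval m e2)
  end.

(* Number of binary digits, with [bitlen 0 = 1]. *)
Definition bitlen (n : nat) : nat := (trunc_log 2 n).+1.

(* Every subexpression, in particular every operand, every address and every
   result, is charged the bit length of its value. *)
Fixpoint expr_cost (m : mem) (e : expr) : nat :=
  bitlen (eval m e) +
  match e with
  | Const _ => 0
  | Read e1 => expr_cost m e1
  | Bin _ e1 e2 => expr_cost m e1 + expr_cost m e2
  end.

(* [Store e1 e2] writes the value of [e2] to the cell whose address is the value
   of [e1]; conditions hold when their value is nonzero. *)
Inductive cmd :=
  | Skip
  | Store of expr & expr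
  | Seq of cmd & cmd
  | If of expr & cmd & cmd
  | While of expr & cmd.

(* [exec p m t m']: started in [m], [p] halts in [m'] after time exactly [t]. *)
Inductive exec : cmd -> mem -> nat -> mem -> Prop :=
  | ExecSkip m : exec Skip m 1 m
  | ExecStore e1 e2 m :
      exec (Store e1 e2) m (expr_cost m e1 + expr_cost m e2)
           (upd m (eval m e1) (eval m e2))
  | ExecSeq p1 p2 m1 m2 m3 t1 t2 :
      exec p1 m1 t1 m2 -> exec p2 m2 t2 m3 -> exec (Seq p1 p2) m1 (t1 + t2) m3
  | ExecIfTrue e p1 p2 m m' t :
      eval m e != 0 -> exec p1 m t m' -> exec (If e p1 p2) m (expr_cost m e + t) m'
  | ExecIfFalse e p1 p2 m m' t :
      eval m e = 0 -> exec p2 m t m' -> exec (If e p1 p2) m (expr_cost m e + t) m'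
  | ExecWhileTrue e p m1 m2 m3 t1 t2 :
      eval m1 e != 0 -> exec p m1 t1 m2 -> exec (While e p) m2 t2 m3 ->
      exec (While e p) m1 (expr_cost m1 e + t1 + t2) m3
  | ExecWhileFalse e p m :
      eval m e = 0 -> exec (While e p) m (expr_cost m e) m.

(* Input and output are finite lists of natural numbers: cell 0 holds the length
   and the following cells hold the entries; all other cells are initially 0. *)
Definition load (s : seq nat) : mem := fun a => nth 0 (size s :: s) a.

Definition output (m : mem) : seq nat := mkseq (fun i => m i.+1) (m 0).

Definition code_size (s : seq nat) : nat := \sum_(n <- s) bitlen n.

(* [sol x s] says that [s] is an acceptable output on the input coded by
   [code x]. *)
Definition poly_time_solvable (I : Type) (code : I -> seq nat)
    (sol : I -> seq nat -> Prop) : Prop :=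
  exists (p : cmd) (a k : nat), forall x : I,
    exists (t : nat) (m : mem),
      [/\ exec p (load (code x)) t m,
          t <= a * code_size (code x) ^ k
        & sol x (output m)].

(** * The FCMJ problem *)

Local Open Scope ring_scope.

Definition is_leaf (n : nat) (edge : rel 'I_n) (v : 'I_n) : bool :=
  [forall w, ~~ edge v w].

Definition arborescence (n : nat) (edge : rel 'I_n) (r : 'I_n) : bool :=
  [&& [forall u, ~~ edge u r],
      [forall (v | v != r), #|[set u | edge u v]| == 1%N]
    & [forall v, connect edge r v]].

(* The nodes are 0, ..., nodes - 1.  The values of [limit] at non-leaves play no
   role: they occur neither in the problem nor in the code of an instance. *)
Record fcmj := FCMJ {
  nodes : nat;
  edge : rel 'I_nodes;
  root : 'I_nodes;
  limit : 'I_nodes -> nat;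
  setup : 'I_nodes -> rat;
  arborescenceP : arborescence edge root;
  root_module : ~~ is_leaf edge root;
  limit_gt0 : forall c : 'I_nodes, is_leaf edge c -> (0 < limit c)%N;
  setup_ge0 : forall v : 'I_nodes, 0 <= setup v
}.

Definition components (X : fcmj) : {set 'I_(nodes X)} :=
  [set v | is_leaf (@edge X) v].

Definition modules (X : fcmj) : {set 'I_(nodes X)} := ~: components X.

Definition child_components (X : fcmj) (m : 'I_(nodes X)) : {set 'I_(nodes X)} :=
  [set c in components X | edge m c].

Definition lcm_set (n : nat) (q : 'I_n -> nat) (C : {set 'I_n}) : nat :=
  \big[lcmn/1%N]_(c in C) q c.

Definition objective (X : fcmj) (q : 'I_(nodes X) -> nat) : rat :=
  \sum_(c in components X) setup c / (q c)%:R
  + \sum_(m in modules X) setup m *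
      \sum_(C : {set 'I_(nodes X)} | (C != set0) && (C \subset child_components m))
         (-1) ^+ (#|C| + 1) / (lcm_set q C)%:R.

Definition feasible (X : fcmj) (q : 'I_(nodes X) -> nat) : Prop :=
  forall c, c \in components X -> (0 < q c <= limit c)%N.

Definition optimal (X : fcmj) (q : 'I_(nodes X) -> nat) : Prop :=
  feasible q /\
  forall q' : 'I_(nodes X) -> nat, feasible q' -> objective q <= objective q'.

(* Number of nodes, root, edges, setup costs as reduced fractions, limits of the
   components.  The lists need no delimiters: a tree on n nodes has n - 1 edges. *)
Definition fcmj_code (X : fcmj) : seq nat :=
  [:: nodes X; val (root X)]
  ++ flatten [seq [:: val u; val v]
             | u <- enum 'I_(nodes X), v <- [seq v <- enum 'I_(nodes X) | edge u v]]
  ++ flatten [seq [:: `|numq (setup v)|%N; `|denq (setup v)|%N]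
             | v <- enum 'I_(nodes X)]
  ++ [seq limit c | c <- enum (components X)].

(* The cycle times are output in increasing order of the component labels. *)
Definition fcmj_solution (X : fcmj) (s : seq nat) : Prop :=
  exists2 q : 'I_(nodes X) -> nat,
    optimal q & s = [seq q c | c <- enum (components X)].

(** * Integer factorization *)

Definition composite (M : nat) : bool := (1 < M)%N && ~~ prime M.

Definition composite_code (x : {M : nat | composite M}) : seq nat := [:: val x].

(* The prime factors are listed with multiplicity, in any order. *)
Definition prime_factorization (x : {M : nat | composite M}) (s : seq nat) : Prop :=
  all prime s /\ (\prod_(p <- s) p)%N = val x.

(* Main.v *)
Require Import Defs.
From mathcomp Require Import all_boot all_order all_algebra.
From mathcomp Require Import zify ring lra.

(** Finding a divisor costs one FCMJ query.  For x >= 2, take a root module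
    with setup cost 1 and two child components: the anchor, with limit x and
    setup cost x^2, and the probe, with limit x - 2 (or 1 when x = 2) and setup
    cost 0.  The large setup cost pins the anchor at the cycle time x
    ([star_optimal]).  The probe, with cycle time b, then only pays for the
    multiples of b that are not multiples of x, whose density is
    1/b - 1/lcm(x, b) = (x - g) / (x b) with g = gcd(x, b).  Since b < x and g
    divides x - b, we have x - g >= b, so the density is at least 1/x, with
    equality exactly when g = x - b, that is, when x - b divides x
    ([inv_sub_inv_lcm_ge]).  If x is composite, a proper divisor d > 1 yields
    the admissible probe time x - d, so every optimal b has x - b as a
    nontrivial divisor of x.  If x is prime no such divisor exists.  Hence the
    same query decides primality: no separate primality test is called for
    ([star_optimal_split]).

    The factorization program keeps a list of integers greater than 1 with
    product M, of which an initial part is known to consist of primes.  It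
    queries the first entry x outside that part; either x is replaced by d and
    x / d, or it joins the prime part.  As a list of integers greater than 1
    with product M has at most log2 M entries, there are at most 2 log2 M
    queries.

    A query runs the given program p inside a larger memory, and p may write to
    addresses that are exponentially large, so its memory cannot be erased
    afterwards.  Instead every query uses a fresh residue class modulo
    N = 16 M: address a of p becomes N (a + 1) + i, where i is increased after
    each query ([runs_reloc]).  This lengthens every address by O(log N) bits,
    hence multiplies the running time by O(log N). *)

Set Implicit Arguments.
Unset Strict Implicit.
Unset Printing Implicit Defensive.

Import Order.TTheory GRing.Theory Num.Theory.

(** * The divisor of an integer read off an optimal maintenance plan *)

Definition star_edge : rel 'I_3 := fun u v => (val u == 0) && (val v != 0).

Lemma star_arborescence : arborescence star_edge ord0.
Proof.
apply/and3P; split; first by apply/forallP=> u; rewrite /star_edge andbF.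
- apply/forall_inP=> v nz_v; rewrite (_ : [set u | _] = [set ord0]) ?cards1 //.
  by apply/setP=> u; rewrite !inE /star_edge -[val v != 0]/(v != ord0) nz_v andbT.
- apply/forallP=> v; have [-> | nz_v] := eqVneq v ord0; first exact: connect0.
  by apply: connect1; rewrite /star_edge /=.
Qed.

Lemma star_leaf v : is_leaf star_edge v = (v != ord0).
Proof.
rewrite /is_leaf /star_edge; have [-> | nz_v] /= := eqVneq v ord0.
  by apply/negP=> /forallP/(_ ord_max).
by apply/forallP=> w; rewrite negb_and; apply/orP; left.
Qed.

Lemma star_root_module : ~~ is_leaf star_edge ord0.
Proof. by rewrite star_leaf eqxx. Qed.

(** The limit 1 + (x - 3) is x - 2 for x >= 3; for x = 2 it is 1, because limits
    must be positive. *)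
Definition star_limit x (c : 'I_3) := if val c == 1 then x else 1 + (x - 3).

Definition star_setup x (v : 'I_3) : rat := (nth 0 [:: 1; x * x; 0] v)%N%:R%R.

Lemma star_limit_gt0 x (x_gt1 : 1 < x) c :
  is_leaf star_edge c -> 0 < star_limit x c.
Proof. by rewrite /star_limit; case: ifP => // _ _; apply: ltnW. Qed.

Lemma star_setup_ge0 x v : (0 <= star_setup x v)%R.
Proof. exact: ler0n. Qed.

Definition star x (x_gt1 : 1 < x) : fcmj :=
  FCMJ star_arborescence star_root_module (star_limit_gt0 x_gt1)
    (star_setup_ge0 x).

Definition anchor : 'I_3 := inord 1.
Definition probe : 'I_3 := inord 2.

Lemma enum_ord3 : enum 'I_3 = [:: ord0; anchor; probe].
Proof. by apply: (inj_map val_inj); rewrite val_enum_ord /= !inordK. Qed.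

Lemma enum_star_components x (x_gt1 : 1 < x) :
  enum (components (star x_gt1)) = [:: anchor; probe].
Proof.
rewrite {1}/enum_mem -enumT enum_ord3 /= !inE !star_leaf eqxx /=.
by rewrite -!val_eqE /= !inordK.
Qed.

Definition star_code x :=
  [:: 3; 0; 0; 1; 0; 2; 1; 1; x * x; 1; 0; 1; x; 1 + (x - 3)].

Lemma fcmj_code_star x (x_gt1 : 1 < x) :
  fcmj_code (star x_gt1) = star_code x.
Proof.
rewrite /fcmj_code enum_star_components /= enum_ord3 /star_edge /= !inordK //=.
rewrite /star_limit /star_setup /= ?inordK //=.
by rewrite -[(x * x)%:R%R]/((x * x)%:Z%:~R)%R numq_int denq_int.
Qed.

Lemma sum_nonempty_subsets2 (T : finType) (u v : T) (F : {set T} -> rat) :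
  u != v ->
  (\sum_(C : {set T} | (C != set0) && (C \subset [set u; v])) F C
   = F [set u] + F [set v] + F [set u; v])%R.
Proof.
move=> neq_uv.
have in_v1 : v \notin [set u] by rewrite inE eq_sym.
have u_neq_v : [set v] != [set u].
  by apply: contra in_v1 => /eqP <-; rewrite inE.
have u_neq_uv : [set u; v] != [set u].
  by apply: contra in_v1 => /eqP <-; rewrite !inE eqxx orbT.
have v_neq_uv : [set u; v] != [set v].
  by apply: contra neq_uv => /eqP/setP/(_ u); rewrite !inE eqxx.
rewrite (bigD1 [set u]) /=; last by rewrite -card_gt0 cards1 subsetUl.
rewrite (bigD1 [set v]) /=; last first.
  by rewrite -card_gt0 cards1 subsetUr u_neq_v.
rewrite (bigD1 [set u; v]) /=; last first.
  by rewrite -card_gt0 cards2 subxx u_neq_uv v_neq_uv.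
rewrite big1 ?addr0 ?addrA // => C /andP[/andP[/andP[/andP[C_n0 sC] Cu] Cv] Cuv].
have memC w : (w \in C) = (w == u) && (u \in C) || (w == v) && (v \in C).
  have := subsetP sC w; rewrite !inE.
  have [-> _ | w_u] := eqVneq w u; first by rewrite (negbTE neq_uv) andTb orbF.
  have [-> _ | w_v] /= := eqVneq w v; first by [].
  by case: (w \in C) => // /(_ isT).
case uC: (u \in C); case vC: (v \in C).
- by case/eqP: Cuv; apply/setP=> w; rewrite memC uC vC !inE !andbT.
- by case/eqP: Cu; apply/setP=> w; rewrite memC uC vC !inE andbT andbF ?orbF.
- by case/eqP: Cv; apply/setP=> w; rewrite memC uC vC !inE andbT andbF ?orbF.
- by case/eqP: C_n0; apply/setP=> w; rewrite memC uC vC !inE !andbF.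
Qed.

Lemma star_objective x (x_gt1 : 1 < x) (q : 'I_3 -> nat) :
  let a := q anchor in let b := q probe in
  (@objective (star x_gt1) q
   = (x * x)%:R / a%:R + (a%:R^-1 + b%:R^-1 - (lcmn a b)%:R^-1))%R.
Proof.
move=> a b; rewrite /objective.
rewrite -big_enum enum_star_components /= !big_cons big_nil.
rewrite {1 2}/star_setup !inordK //= mul0r !addr0.
have -> : modules (star x_gt1) = [set ord0].
  by apply/setP=> v; rewrite !inE star_leaf negbK.
rewrite big_set1 /= /star_setup /= mul1r.
have -> : @child_components (star x_gt1) ord0 = [set anchor; probe].
  apply/setP=> v; rewrite !inE star_leaf /star_edge /=.
  rewrite -!val_eqE /= !inordK //; case: v => -[|[|[|]]] //.
have neq12 : anchor != probe by rewrite -val_eqE /= !inordK.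
rewrite sum_nonempty_subsets2 // /lcm_set !big_set1 !cards1 cards2 neq12.
rewrite big_setU1 ?inE //= big_set1 -/a -/b.
by rewrite !exprS expr0; ring.
Qed.

Lemma gcdn_le_sub x b : b < x -> gcdn x b <= x - b.
Proof.
move=> b_lt; apply: dvdn_leq; first by rewrite subn_gt0.
by rewrite dvdn_sub ?dvdn_gcdl ?dvdn_gcdr.
Qed.

Local Open Scope ring_scope.

Lemma inv_sub_inv_lcm (x b : nat) : (0 < x)%N -> (0 < b)%N ->
  b%:R^-1 - (lcmn x b)%:R^-1 = (x%:R - (gcdn x b)%:R) / (x%:R * b%:R) :> rat.
Proof.
move=> x_gt0 b_gt0.
have l_gt0 : (0 < lcmn x b)%N by rewrite lcmn_gt0 x_gt0.
have /(congr1 (fun n => n%:R : rat)) := muln_lcm_gcd x b.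
rewrite !natrM => e.
have [x0 b0 l0] : [/\ x%:R != 0 :> rat, b%:R != 0 :> rat & (lcmn x b)%:R != 0 :> rat].
  by rewrite !pnatr_eq0 -!lt0n.
apply: (mulIf (mulf_neq0 x0 b0)); rewrite mulfVK ?mulf_neq0 //.
by rewrite mulrBl -{2}e; field; rewrite l0 b0.
Qed.

(** The left-hand side b / (x b) is compared with (x - g) / (x b), where g is the
    gcd of x and b; g divides x - b, and equals it exactly when x - b divides
    x. *)
Lemma inv_sub_inv_lcm_ge (x b : nat) : (0 < b < x)%N ->
  x%:R^-1 <= b%:R^-1 - (lcmn x b)%:R^-1
    ?= iff (x - b %| x)%N :> rat.
Proof.
case/andP=> b_gt0 b_lt; have x_gt0 := ltn_trans b_gt0 b_lt.
have g_le := gcdn_le_sub b_lt.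
have [x0 b0] : 0 < x%:R :> rat /\ 0 < b%:R :> rat by rewrite !ltr0n.
rewrite inv_sub_inv_lcm //.
have -> : x%:R^-1 = b%:R / (x%:R * b%:R) :> rat by field; lra.
rewrite -natrB; last lia.
have -> : (x - b %| x)%N = (b == x - gcdn x b)%N.
  apply/idP/eqP => [xb_dvd | e].
    suff: (x - b %| gcdn x b)%N by move/dvdn_leq; rewrite gcdn_gt0; lia.
    by rewrite dvdn_gcd xb_dvd -[X in (_ %| X)%N](subKn (ltnW b_lt)) dvdn_sub.
  by rewrite (_ : (x - b)%N = gcdn x b) ?dvdn_gcdl //; lia.
split; last by rewrite (inj_eq (mulIf _)) ?eqr_nat // invr_eq0; apply/lt0r_neq0/mulr_gt0.
by rewrite ler_pM2r ?invr_gt0 ?mulr_gt0 // ler_nat; lia.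
Qed.

Local Close Scope ring_scope.

Definition two_cycles (a b : nat) : 'I_3 -> nat :=
  fun c => if c == anchor then a else b.

Lemma two_cycles_snd a b : two_cycles a b probe = b.
Proof. by rewrite /two_cycles -val_eqE /= !inordK. Qed.

Lemma star_feasibleP x (x_gt1 : 1 < x) (q : 'I_3 -> nat) :
  @feasible (star x_gt1) q <->
  0 < q anchor <= x /\ 0 < q probe <= 1 + (x - 3).
Proof.
have E c : (c \in components (star x_gt1)) = (c \in [:: anchor; probe]).
  by rewrite -(enum_star_components x_gt1); apply/esym/mem_enum.
split=> [feas | [ok1 ok2] c]; last first.
  by rewrite E !inE => /orP[] /eqP -> /=; rewrite /star_limit /= inordK.
have := feas anchor; have := feas probe.
rewrite !E !inE !eqxx orbT /= /star_limit /= !inordK //=.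
by move=> /(_ isT) ok2 /(_ isT) ok1.
Qed.

(** Cost x^2 is enough to pin the anchor: with a < x it alone pays
    x^2 / a >= x^2 / (x - 1) > x + 1, whereas the times x and 1 cost x + 1 in
    total.  With the anchor at x, all costs but the density in
    [inv_sub_inv_lcm_ge] are constant, so an optimal probe attains the minimum
    1/x as soon as some admissible probe time does. *)
Lemma star_optimal x (x_gt1 : 1 < x) (q : 'I_3 -> nat) :
  @optimal (star x_gt1) q ->
  [/\ q anchor = x, 0 < q probe < x &
    forall b, 0 < b <= 1 + (x - 3) -> x - b %| x -> x - q probe %| x].
Proof.
case=> /star_feasibleP[]; set a := q anchor; set b := q probe.
move=> /andP[a_gt0 a_le] /andP[b_gt0 b_le] opt.
have b_lt : b < x by lia.
have better a' b' : 0 < a' <= x -> 0 < b' <= 1 + (x - 3) ->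
  ((x * x)%:R / a%:R + (a%:R^-1 + b%:R^-1 - (lcmn a b)%:R^-1) <=
   (x * x)%:R / a'%:R + (a'%:R^-1 + b'%:R^-1 - (lcmn a' b')%:R^-1) :> rat)%R.
  move=> ok1 ok2.
  have feas : @feasible (star x_gt1) (two_cycles a' b').
    by apply/star_feasibleP; rewrite two_cycles_snd /two_cycles eqxx.
  have := opt _ feas.
  by rewrite !star_objective two_cycles_snd /two_cycles eqxx.
have a_eq : a = x.
  apply/eqP; rewrite eqn_leq a_le /= leqNgt; apply/negP=> a_lt.
  (* The competitor (x, 1) costs x + 1/x + 1 - 1/x = x + 1. *)
  have := better x 1; rewrite leqnn (ltnW x_gt1) /= => /(_ isT isT).
  have l_ge : ((lcmn a b)%:R^-1 <= b%:R^-1 :> rat)%R.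
    rewrite lef_pV2 ?posrE ?ltr0n ?lcmn_gt0 ?a_gt0 ?b_gt0 // ler_nat.
    by rewrite dvdn_leq ?lcmn_gt0 ?a_gt0 ?b_gt0 // dvdn_lcmr.
  have a0 : (0 < a%:R :> rat)%R by rewrite ltr0n.
  have : (x%:R + 1 < (x * x)%:R / a%:R :> rat)%R.
    by rewrite ltr_pdivlMr // natr1 -natrM ltr_nat; nia.
  have -> : ((x * x)%:R / x%:R = x%:R :> rat)%R.
    by rewrite natrM mulfK // pnatr_eq0; lia.
  have : (0 < a%:R^-1 :> rat)%R by rewrite invr_gt0.
  rewrite lcmn1 invr1; lra.
split=> //; first by rewrite b_gt0.
move=> b' ok xb'_dvd; have b'_lt : 0 < b' < x by lia.
have := better x b'; rewrite leqnn (ltnW x_gt1) /= => /(_ isT ok).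
rewrite a_eq -!addrA !lerD2l.
have [_] := inv_sub_inv_lcm_ge b'_lt; rewrite xb'_dvd => /eqP <-.
have /inv_sub_inv_lcm_ge[ge <-] : 0 < b < x by rewrite b_gt0.
by rewrite eq_le ge.
Qed.

(** For composite x there is a divisor e with 1 < e < x, and x - e is within the
    limit of the probe; so the optimal probe time also gives a divisor, which
    the limit x - 2 forces to exceed 1. *)
Lemma star_optimal_split x (x_gt1 : 1 < x) (q : 'I_3 -> nat) :
  let d := x - q probe in
  @optimal (star x_gt1) q -> ~~ ((1 < d) && (d %| x)) -> prime x.
Proof.
move=> d opt; apply: contraR => x_comp.
have [_ /andP[b_gt0 b_lt] best] := star_optimal opt.
have [e e_bd e_dvd] : exists2 e, 1 < e < x & e %| x.
  case/primePn: x_comp => [|[e e_bd e_dvd]]; last by exists e.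
  by rewrite ltnNge x_gt1.
have := best (x - e); rewrite subKn; last lia.
move=> /(_ _ e_dvd) d_dvd.
have xb : 3 < x.
  have /dvdnP[k xE] := e_dvd; have : 1 < k by rewrite ltnNge; apply/negP; nia.
  nia.
have ok := star_feasibleP x_gt1 q; have [/ok[_ /andP[_ b_le]] _] := opt.
by rewrite /d d_dvd ?andbT; lia.
Qed.

(** * Binary length *)

Lemma bitlen_gt0 n : 0 < bitlen n.
Proof. by []. Qed.

Lemma ltn_bitlen n : n < 2 ^ bitlen n.
Proof. exact: trunc_log_ltn. Qed.

Lemma bitlen_le_exp n k : 0 < k -> n < 2 ^ k -> bitlen n <= k.
Proof.
move=> k_gt0; case: n => [|n] lt_nk; first by rewrite /bitlen trunc_log0.
rewrite /bitlen ltnNge; apply/negP=> le_k.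
have := leq_ltn_trans (trunc_logP (isT : 1 < 2) (ltn0Sn n)) lt_nk.
by rewrite ltn_exp2l // ltnNge le_k.
Qed.

Lemma leq_bitlen : {homo bitlen : m n / m <= n}.
Proof. by move=> m n le_mn; rewrite ltnS leq_trunc_log. Qed.

Lemma bitlenM m n : bitlen (m * n) <= bitlen m + bitlen n.
Proof. by apply: bitlen_le_exp => //; rewrite expnD ltn_mul ?ltn_bitlen. Qed.

Lemma bitlenD m n : bitlen (m + n) <= bitlen m + bitlen n.
Proof.
have [-> | m_gt0] := posnP m; first by rewrite leq_addl.
have [-> | n_gt0] := posnP n; first by rewrite addn0 leq_addr.
apply: bitlen_le_exp => //; rewrite expnD.
have := ltn_bitlen m; have := ltn_bitlen n; nia.
Qed.

(** * Upper bounds on running times *)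

Definition runs_to p m T m' := exists2 t, exec p m t m' & t <= T.

Lemma runs_le p m T T' m' : T <= T' -> runs_to p m T m' -> runs_to p m T' m'.
Proof. by move=> le_T [t ex le_t]; exists t; last exact: leq_trans le_T. Qed.

Lemma runs_seq p1 p2 m1 m2 m3 T1 T2 :
  runs_to p1 m1 T1 m2 -> runs_to p2 m2 T2 m3 ->
  runs_to (Seq p1 p2) m1 (T1 + T2) m3.
Proof.
move=> [t1 ex1 le1] [t2 ex2 le2]; exists (t1 + t2); last exact: leq_add.
exact: ExecSeq ex1 ex2.
Qed.

Fixpoint bounded (V : nat) (m : Defs.mem) (e : expr) : bool :=
  (eval m e <= V) &&
  match e with
  | Const _ => true
  | Read e1 => bounded V m e1
  | Bin _ e1 e2 => bounded V m e1 && bounded V m e2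
  end.

Fixpoint expr_size (e : expr) : nat :=
  match e with
  | Const _ => 1
  | Read e1 => (expr_size e1).+1
  | Bin _ e1 e2 => (expr_size e1 + expr_size e2).+1
  end.

Lemma expr_cost_bounded V m e :
  bounded V m e -> expr_cost m e <= expr_size e * bitlen V.
Proof.
elim: e => [n | e IHe | o e1 IH1 e2 IH2] /=.
- by rewrite andbT mul1n addn0 => /leq_bitlen.
- by case/andP=> /leq_bitlen le1 /IHe le2; rewrite mulSn leq_add.
- by case/and3P=> /leq_bitlen le0 /IH1 le1 /IH2 le2; rewrite mulSn mulnDl !leq_add.
Qed.

Lemma runs_store V m e1 e2 a v :
  eval m e1 = a -> eval m e2 = v -> bounded V m e1 -> bounded V m e2 ->
  runs_to (Store e1 e2) m ((expr_size e1 + expr_size e2) * bitlen V) (upd m a v).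
Proof.
move=> <- <- b1 b2; exists (expr_cost m e1 + expr_cost m e2).
  exact: ExecStore.
by rewrite mulnDl leq_add ?expr_cost_bounded.
Qed.

Lemma runs_if V m e p1 p2 T m' :
  bounded V m e ->
  runs_to (if eval m e != 0 then p1 else p2) m T m' ->
  runs_to (If e p1 p2) m (expr_size e * bitlen V + T) m'.
Proof.
move=> be; case: eqP => /= [e0 | /eqP e0] [t ex le_t]; exists (expr_cost m e + t);
  rewrite ?leq_add ?expr_cost_bounded //.
- exact: ExecIfFalse.
- exact: ExecIfTrue.
Qed.

Lemma runs_while_true V m1 m2 m3 e p T1 T2 :
  eval m1 e != 0 -> bounded V m1 e -> runs_to p m1 T1 m2 ->
  runs_to (While e p) m2 T2 m3 ->
  runs_to (While e p) m1 (expr_size e * bitlen V + T1 + T2) m3.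
Proof.
move=> e0 be [t1 ex1 le1] [t2 ex2 le2]; exists (expr_cost m1 e + t1 + t2).
  exact: ExecWhileTrue ex2.
by rewrite !leq_add ?expr_cost_bounded.
Qed.

Lemma runs_while_false V m e p :
  eval m e = 0 -> bounded V m e ->
  runs_to (While e p) m (expr_size e * bitlen V) m.
Proof.
move=> e0 be; exists (expr_cost m e); first exact: ExecWhileFalse.
exact: expr_cost_bounded.
Qed.

Lemma upd_same m a v : upd m a v a = v.
Proof. by rewrite /upd eqxx. Qed.

Lemma upd_other m a v b : b <> a -> upd m a v b = m b.
Proof. by rewrite /upd => /eqP/negbTE->. Qed.

(** * Relocating a program into a residue class *)

(** Cell 0 holds the stride N; the variables sit at N + 1, N + 2, N + 3, the
    first of them being the offset i of the residue class in use. *)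
Definition stride := Read (Const 0).
Definition var_addr j := Bin Add stride (Const j).
Definition var j := Read (var_addr j).
Definition offset := var 1.
Definition shift e := Bin Add (Bin Mul stride (Bin Add e (Const 1))) offset.

Fixpoint reloc_expr e :=
  match e with
  | Const n => Const n
  | Read e1 => Read (shift (reloc_expr e1))
  | Bin o e1 e2 => Bin o (reloc_expr e1) (reloc_expr e2)
  end.

Fixpoint reloc p :=
  match p with
  | Skip => Skip
  | Store e1 e2 => Store (shift (reloc_expr e1)) (reloc_expr e2)
  | Seq p1 p2 => Seq (reloc p1) (reloc p2)
  | If e p1 p2 => If (reloc_expr e) (reloc p1) (reloc p2)
  | While e p1 => While (reloc_expr e) (reloc p1)
  end.

(** The factor a + 1 keeps the cells 1, ..., N - 1 out of all regions: there the
    list of factors is stored. *)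
Definition cell N i a := N * (a + 1) + i.

Definition in_region N i b := (N <= b) && (b %% N == i).

Record frame N i (h : Defs.mem) : Prop := Frame {
  frame_stride : h 0 = N;
  frame_offset : h (N + 1) = i;
  frame_offset_gt : 3 < i;
  frame_offset_lt : i < N
}.

Definition embeds N i (h m : Defs.mem) := forall a, h (cell N i a) = m a.

Definition unchanged_off N i (h h' : Defs.mem) :=
  forall b, ~~ in_region N i b -> h' b = h b.

Lemma cell_in_region N i a : i < N -> in_region N i (cell N i a).
Proof.
move=> lt_iN; rewrite /in_region /cell (mulnC N) modnMDl modn_small // eqxx.
by rewrite andbT; nia.
Qed.

Lemma low_notin_region N i b : b < N -> ~~ in_region N i b.
Proof. by rewrite ltnNge /in_region => /negbTE->. Qed.

Lemma cell_notin_region N i j a : j < N -> i != j -> ~~ in_region N i (cell N j a).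
Proof.
move=> lt_jN neq; rewrite /in_region /cell (mulnC N) modnMDl modn_small //.
by rewrite eq_sym (negbTE neq) andbF.
Qed.

Lemma var_notin_region N i j : j <= 3 < i -> i < N -> ~~ in_region N i (N + j).
Proof.
move=> j3i lt_iN; have := @cell_notin_region N i j 0; rewrite /cell add0n muln1.
by apply; lia.
Qed.

Lemma cell_inj N i a b : 0 < N -> cell N i a = cell N i b -> a = b.
Proof. by rewrite /cell; nia. Qed.

Lemma frame_unchanged N i h h' :
  frame N i h -> unchanged_off N i h h' -> frame N i h'.
Proof.
case=> h0 h1 i_gt i_lt off; split=> //.
  by rewrite off ?low_notin_region //; lia.
by rewrite off ?var_notin_region ?i_gt.
Qed.

Lemma eval_shift N i h e : frame N i h -> eval h (shift e) = cell N i (eval h e).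
Proof. by case=> h0 h1 _ _; rewrite /= h0 h1. Qed.

Lemma eval_reloc N i h m e :
  frame N i h -> embeds N i h m -> eval h (reloc_expr e) = eval m e.
Proof.
move=> fr em; elim: e => [n | e IHe | o e1 IH1 e2 IH2] //=; last by rewrite IH1 IH2.
by rewrite -[X in h X]/(eval h (shift _)) (eval_shift _ fr) em IHe.
Qed.

(** A shifted address has 11 subexpressions besides e.  Each of their values is
    at most N (v + 2), where v is the value of e, and so has at most
    4 bitlen N bitlen v bits. *)
Lemma cost_shift N i h e : frame N i h ->
  expr_cost h (shift e) <= expr_cost h e + 44 * bitlen N * bitlen (eval h e).
Proof.
case=> h0 h1 i_gt i_lt /=; rewrite h0 h1.
set v := eval h e.
have N_v w : w <= N * (v + 2) -> bitlen w <= 4 * (bitlen N * bitlen v).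
  move/leq_bitlen/leq_trans; apply; have b2 : bitlen 2 = 2 by [].
  have := bitlenM N (v + 2); have := bitlenD v 2.
  have := bitlen_gt0 N; have := bitlen_gt0 v; nia.
have v_le : v <= N * v by rewrite leq_pmull //; lia.
have := N_v (N * (v + 1) + i); have := N_v (N * (v + 1)); have := N_v N.
have := N_v 0; have := N_v (v + 1); have := N_v 1; have := N_v i; have := N_v (N + 1).
rewrite -mulnA !mulnDr muln1; move: (bitlen N * bitlen v) => c; lia.
Qed.

Definition slowdown N := 1 + 44 * bitlen N.

(** The second summand on the left strengthens the induction: every
    subexpression pays in advance, out of the bits of its own value, for being
    used as an address by [shift]. *)
Lemma cost_reloc N i h m e : frame N i h -> embeds N i h m ->
  expr_cost h (reloc_expr e) + 44 * bitlen N * bitlen (eval m e)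
    <= slowdown N * expr_cost m e.
Proof.
move=> fr em; rewrite /slowdown.
elim: e => [n | e IHe | o e1 IH1 e2 IH2].
- by rewrite /= !addn0 mulnDl mul1n.
- have := cost_shift (reloc_expr e) fr; rewrite (eval_reloc _ fr em).
  rewrite -[expr_cost h (reloc_expr (Read e))]/(bitlen (eval h (reloc_expr (Read e)))
    + expr_cost h (shift (reloc_expr e))) (eval_reloc _ fr em).
  rewrite -[expr_cost m (Read e)]/(bitlen (eval m (Read e)) + expr_cost m e).
  lia.
- rewrite -[expr_cost h _]/(bitlen (eval h (reloc_expr (Bin o e1 e2)))
    + (expr_cost h (reloc_expr e1) + expr_cost h (reloc_expr e2))).
  rewrite (eval_reloc _ fr em).
  rewrite -[expr_cost m (Bin o e1 e2)]/(bitlen (eval m (Bin o e1 e2))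
    + (expr_cost m e1 + expr_cost m e2)).
  lia.
Qed.

(** The relocated program only touches its own residue class; cell 0 and the
    offset lie outside of it, so the relocation stays in force during the
    run. *)
Lemma runs_reloc p m t m' : exec p m t m' ->
  forall N i h, frame N i h -> embeds N i h m ->
  exists h', [/\ runs_to (reloc p) h (slowdown N * t) h',
                 embeds N i h' m' & unchanged_off N i h h'].
Proof.
elim=> {p m t m'}.
- move=> m N i h fr em; exists h; split=> //.
  by exists 1; [exact: ExecSkip | rewrite muln1].
- move=> e1 e2 m N i h fr em.
  have N_gt0 : 0 < N by case: fr; lia.
  exists (upd h (cell N i (eval m e1)) (eval m e2)); split.
  + exists (expr_cost h (shift (reloc_expr e1)) + expr_cost h (reloc_expr e2)).
      have := ExecStore (shift (reloc_expr e1)) (reloc_expr e2) h.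
      by rewrite (eval_shift _ fr) !(eval_reloc _ fr em).
    have := cost_shift (reloc_expr e1) fr; rewrite (eval_reloc _ fr em).
    have := cost_reloc e1 fr em; have := cost_reloc e2 fr em; nia.
  + move=> a; rewrite /upd; have [-> | ne] := eqVneq a (eval m e1).
      by rewrite eqxx.
    by case: eqP => [/(cell_inj N_gt0)/eqP | _]; rewrite ?(negbTE ne) ?em.
  + move=> b b_off; rewrite upd_other // => b_eq; move: b_off.
    by rewrite b_eq cell_in_region //; case: fr.
- move=> p1 p2 m1 m2 m3 t1 t2 _ IH1 _ IH2 N i h fr em.
  have [h1 [run1 em1 off1]] := IH1 _ _ _ fr em.
  have [h2 [run2 em2 off2]] := IH2 _ _ _ (frame_unchanged fr off1) em1.
  exists h2; split=> //; first by rewrite mulnDr; apply: runs_seq run1 run2.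
  by move=> b b_off; rewrite off2 ?off1.
- move=> e p1 p2 m m' t e0 _ IH N i h fr em.
  have [h1 [[t1 ex1 le1] em1 off1]] := IH _ _ _ fr em.
  exists h1; split=> //; exists (expr_cost h (reloc_expr e) + t1).
    by apply: ExecIfTrue; rewrite ?(eval_reloc _ fr em).
  by have := cost_reloc e fr em; lia.
- move=> e p1 p2 m m' t e0 _ IH N i h fr em.
  have [h1 [[t1 ex1 le1] em1 off1]] := IH _ _ _ fr em.
  exists h1; split=> //; exists (expr_cost h (reloc_expr e) + t1).
    by apply: ExecIfFalse; rewrite ?(eval_reloc _ fr em).
  by have := cost_reloc e fr em; lia.
- move=> e p m1 m2 m3 t1 t2 e0 _ IH1 _ IH2 N i h fr em.
  have [h1 [[s1 ex1 le1] em1 off1]] := IH1 _ _ _ fr em.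
  have [h2 [[s2 ex2 le2] em2 off2]] := IH2 _ _ _ (frame_unchanged fr off1) em1.
  exists h2; split=> //; last by move=> b b_off; rewrite off2 ?off1.
  exists (expr_cost h (reloc_expr e) + s1 + s2).
    by apply: ExecWhileTrue ex1 ex2; rewrite (eval_reloc _ fr em).
  by have := cost_reloc e fr em; lia.
- move=> e p m e0 N i h fr em; exists h; split=> //.
  exists (expr_cost h (reloc_expr e)).
    by apply: ExecWhileFalse; rewrite (eval_reloc _ fr em).
  by have := cost_reloc e fr em; lia.
Qed.

(** * The memory of the factorization program *)

Fixpoint fill a (es : seq expr) : cmd :=
  if es is e :: es' then Seq (Store (shift (Const a)) e) (fill a.+1 es') else Skip.

(** 12 is the number of subexpressions of an address [shift (Const a)]. *)
Definition fill_size (es : seq expr) := sumn [seq 12 + expr_size e | e <- es].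

(** The expressions are evaluated one at a time, after part of the region has
    been filled; hence the hypothesis that their values do not depend on the
    region. *)
Lemma runs_fill V N i h0 es : forall vs a h,
  frame N i h0 -> unchanged_off N i h0 h ->
  (forall h', unchanged_off N i h0 h' ->
     [seq eval h' e | e <- es] = vs /\ all (bounded V h') es) ->
  N * (a + size es + 1) <= V ->
  (forall b, a <= b -> h (cell N i b) = 0) ->
  exists h', [/\ runs_to (fill a es) h (fill_size es * bitlen V + 1) h',
    unchanged_off N i h0 h' &
    forall b, h' (cell N i b) = if b < a then h (cell N i b) else nth 0 vs (b - a)].
Proof.
elim: es => [|e es IHes] vs a h fr off evs le_V zeros.
  have [<- _] := evs _ off; exists h; split=> //.
    by exists 1; first exact: ExecSkip.
  by move=> b; case: ltnP => // /zeros->; rewrite nth_nil.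
have [fr0 fr1 i_gt i_lt] := frame_unchanged fr off.
have /= [vsE /andP[bd_e _]] := evs _ off.
set h1 := upd h (cell N i a) (eval h e).
have off1 : unchanged_off N i h0 h1.
  move=> b b_off; rewrite -(off b b_off) /h1 upd_other // => b_eq.
  by rewrite b_eq cell_in_region in b_off.
have {IHes} := IHes (behead vs) a.+1 h1 fr off1.
case=> [h' off' | | b lt_ab | h2 [run2 off2 val2]].
- have /= [<- /andP[_ ?]] := evs _ off'; split=> //.
- by rewrite addSnnS.
- rewrite /h1 upd_other ?zeros ?(ltnW lt_ab) // => /cell_inj; lia.
exists h2; split=> //.
- rewrite /fill_size /= -/(fill_size es) mulnDl -addnA.
  apply: runs_seq run2; apply: runs_store => //.
    by rewrite (eval_shift _ (Frame fr0 fr1 i_gt i_lt)).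
  by rewrite /= fr0 fr1; move: le_V => /=; nia.
- move=> b; rewrite val2 /h1; case: (ltngtP b a) => [lt_ba | lt_ab | ->].
  + by rewrite ltnS ltnW // upd_other // => /cell_inj; lia.
  + rewrite ltnS leqNgt lt_ab /= -vsE -(subnSK lt_ab) /=.
    by [].
  + by rewrite ltnSn upd_same subnn -vsE.
Qed.

Definition len := var 2.
Definition idx := var 3.
Definition cur_addr := Bin Add idx (Const 1).
Definition cur := Read cur_addr.

(** P is the list of primes found and R lists the integers that remain to be
    treated.  The offset i may differ from z, from which on residue classes are
    unused: during a query z = i + 1. *)
Record layout N i z (P R : seq nat) (h : Defs.mem) : Prop := Layout {
  layout_frame : frame N i h;
  layout_len : h (N + 2) = size (P ++ R);
  layout_idx : h (N + 3) = size P;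
  layout_list : forall j, j < size (P ++ R) -> h (j + 1) = nth 0 (P ++ R) j;
  layout_size : size (P ++ R) < N;
  layout_fresh : forall j a, z <= j < N -> h (cell N j a) = 0
}.

Lemma layout_unchanged N i z P R h h' : z <= i.+1 ->
  layout N i z P R h -> unchanged_off N i h h' -> layout N i i.+1 P R h'.
Proof.
move=> le_z [fr hl hi hL sz zeros] off; have [h0 h1 i_gt i_lt] := fr.
split=> //; first exact: frame_unchanged off.
- by rewrite off ?var_notin_region.
- by rewrite off ?var_notin_region.
- by move=> j lt_j; rewrite off ?hL ?low_notin_region //; lia.
- by move=> j a lt_j; rewrite off ?zeros ?cell_notin_region //; lia.
Qed.

Lemma cell_neq_var N i j a : j <= 3 < i -> i < N -> cell N i a <> N + j.
Proof. by move=> j3i lt_i e; have := var_notin_region j3i lt_i; rewrite -e cell_in_region. Qed.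

Lemma cell_ge N i a : N <= cell N i a.
Proof. rewrite /cell; nia. Qed.

Lemma layout_incr_offset N i P R h : i.+1 < N ->
  layout N i i.+1 P R h -> layout N i.+1 i.+1 P R (upd h (N + 1) i.+1).
Proof.
move=> lt_iN [[h0 h1 i_gt i_lt] hl hi hL sz zeros].
split=> //; [|by rewrite upd_other //; lia|by rewrite upd_other //; lia| |].
- by split=> //; rewrite ?upd_same ?upd_other //; lia.
- by move=> j lt_j; rewrite upd_other ?hL //; lia.
- by move=> j a lt_j; rewrite upd_other ?zeros //; apply: cell_neq_var; lia.
Qed.

Lemma layout_next N i z P x R h : i < z ->
  layout N i z P (x :: R) h -> layout N i z (rcons P x) R (upd h (N + 3) (size P).+1).
Proof.
move=> lt_iz [[h0 h1 i_gt i_lt] hl hi hL sz zeros].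
rewrite -cat_rcons in hl hL sz.
split=> //; [|by rewrite upd_other //; lia|by rewrite upd_same size_rcons| |].
- by split=> //; rewrite upd_other //; lia.
- by move=> j lt_j; rewrite upd_other ?hL //; lia.
- by move=> j a lt_j; rewrite upd_other ?zeros //; apply: cell_neq_var; lia.
Qed.

(** The current entry becomes d, and e is appended at the end of the list, so
    that no entry has to be moved. *)
Lemma layout_split N i z P x R h d e : i < z ->
  (size (P ++ x :: R)).+1 < N ->
  layout N i z P (x :: R) h ->
  layout N i z P (d :: rcons R e)
    (upd (upd (upd h (size (P ++ x :: R)).+1 e) (size P).+1 d)
      (N + 2) (size (P ++ x :: R)).+1).
Proof.
move=> lt_iz lt_sz [[h0 h1 i_gt i_lt] hl hi hL sz zeros].
have nE : size (P ++ x :: R) = size P + (size R).+1 by rewrite size_cat.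
have szE : size (P ++ d :: rcons R e) = (size (P ++ x :: R)).+1.
  by rewrite !size_cat /= size_rcons addnS.
split; rewrite ?szE //.
- by split=> //; rewrite !upd_other //; lia.
- by rewrite upd_same.
- by rewrite !upd_other //; lia.
- move=> j lt_j; rewrite upd_other; last lia.
  rewrite addn1 nth_cat; have [lt_jP | le_Pj] := ltnP.
    by rewrite !upd_other; try lia; rewrite -addn1 hL ?nth_cat ?lt_jP //; lia.
  have [-> | ne_j] := eqVneq j (size P); first by rewrite upd_same subnn.
  rewrite upd_other; last by lia.
  have -> : j - size P = (j - size P).-1.+1 by lia.
  rewrite /= nth_rcons /upd eqSS.
  have [-> | ne] := eqVneq j (size (P ++ x :: R)).
    by rewrite ifF ?ifT //; lia.
  rewrite ifT; last lia.
  rewrite -addn1 hL; last lia.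
  rewrite nth_cat ifF; last lia.
  by have -> : j - size P = (j - size P).-1.+1 by lia.
- move=> j a lt_j; have := cell_ge N j a => ge_N.
  rewrite !upd_other ?zeros //; try lia.
  by apply: cell_neq_var; lia.
Qed.

(** * One query *)

(** The contents of the cells 0, ..., 14 that encode the instance for the current
    entry; 14 is the length of the code. *)
Definition star_exprs : seq expr :=
  [seq Const n | n <- [:: 14; 3; 0; 0; 1; 0; 2; 1; 1]]
  ++ [:: Bin Mul cur cur; Const 1; Const 0; Const 1; cur;
      Bin Add (Const 1) (Bin Defs.Sub cur (Const 3))].

(** Cell 2 of the relocated program holds the second number that it outputs, the
    cycle time of the probe. *)
Definition divisor := Bin Defs.Sub cur (Read (shift (Const 2))).
(** With d the value of [divisor] and x the current entry, the value is nonzero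
    exactly when d > 1 and d divides x ([eval_splits]). *)
Definition splits :=
  Bin Mul (Bin Defs.Sub divisor (Const 1)) (Bin Defs.Sub (Const 1) (Bin Mod cur divisor)).
Definition incr j := Store (var_addr j) (Bin Add (var j) (Const 1)).
(** The quotient is stored first: [divisor] reads the entry that the second store
    overwrites. *)
Definition split_cmd :=
  Seq (Store (Bin Add len (Const 1)) (Bin Div cur divisor))
    (Seq (Store cur_addr divisor) (incr 2)).
Definition body p :=
  Seq (fill 0 star_exprs)
    (Seq (reloc p) (Seq (If splits split_cmd (incr 3)) (incr 1))).

Lemma layout_cur N i z P x R h : layout N i z P (x :: R) h -> h (size P + 1) = x.
Proof.
case=> _ _ _ hL _ _; rewrite hL ?nth_cat ?ltnn ?subnn //.
by rewrite size_cat /= addnS ltnS leq_addr.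
Qed.

Lemma runs_incr V j m : m 0 + j <= V -> (m (m 0 + j)).+1 <= V ->
  runs_to (incr j) m (11 * bitlen V) (upd m (m 0 + j) (m (m 0 + j)).+1).
Proof.
move=> le_V le_V'; apply: (@runs_store V); rewrite //= ?addn1 //; lia.
Qed.

Lemma eval_splits x d : ((d - 1) * (1 - x %% d) != 0) = (1 < d) && (d %| x).
Proof. by rewrite muln_eq0 negb_or !subn_eq0 -!ltnNge ltnS leqn0. Qed.

Lemma runs_load_star V N i P x R h :
  1 < x -> x <= N -> 20 * N <= V -> N * N <= V ->
  layout N i i P (x :: R) h ->
  exists h', [/\ runs_to (fill 0 star_exprs) h (fill_size star_exprs * bitlen V + 1) h',
    layout N i i.+1 P (x :: R) h' & embeds N i h' (load (star_code x))].
Proof.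
move=> x_gt1 x_le le_V1 le_V2 L; have fr := layout_frame L.
have sz_N := layout_size L.
have [||||h' [run off val]] := @runs_fill V N i h star_exprs (14 :: star_code x) 0 h fr.
- by [].
- move=> h' off; have L' := layout_unchanged (leqnSn i) L off.
  have [[h0 h1 i_gt i_lt] hl hi hL sz _] := L'.
  have hx := layout_cur L'.
  rewrite /= !(h0, hi, hx); split=> //.
  have xx : x * x <= V by nia.
  have szP : size P + 1 < N by move: sz; rewrite size_cat /=; lia.
  by move: xx; move: (x * x) => xx; lia.
- by rewrite /=; lia.
- move=> b _; apply: (layout_fresh L); case: fr => *; lia.
exists h'; split=> //; first exact: layout_unchanged (leqnSn i) L off.
by move=> b; rewrite val ltn0 subn0.
Qed.

Lemma runs_split_cmd V N i z P x b R h : i < z -> 0 < b < x ->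
  x <= N -> 20 * N <= V ->
  (size (P ++ x :: R)).+1 < N -> layout N i z P (x :: R) h -> h (cell N i 2) = b ->
  exists2 h', runs_to split_cmd h (100 * bitlen V) h' &
    layout N i z P (x - b :: rcons R (x %/ (x - b))) h'.
Proof.
move=> lt_iz b_x x_le le_V lt_sz L hb.
have L' := layout_split (x - b) (x %/ (x - b)) lt_iz lt_sz L.
have [[h0 h1 i_gt i_lt] hl hi hL sz _] := L.
have hx := layout_cur L; have szE : size (P ++ x :: R) = size P + (size R).+1 by rewrite size_cat.
rewrite /cell in hb; have div_le : x %/ (x - b) <= x by apply: leq_div.
eexists; last exact: L'.
apply: (@runs_le _ _ (38 * bitlen V + (29 * bitlen V + 11 * bitlen V))); first lia.
apply: runs_seq.
  apply: (@runs_store V); rewrite /= ?(h0, h1, hl, hi, hx, hb) ?addn1 //; lia.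
set g := upd h _ _.
have [g0 g1 g3] : [/\ g 0 = N, g (N + 1) = i & g (N + 3) = size P].
  by split; rewrite /g !upd_other //; lia.
have [gx gb] : g (size P + 1) = x /\ g (N * (2 + 1) + i) = b.
  by split; rewrite /g !upd_other //; lia.
apply: runs_seq.
  apply: (@runs_store V); rewrite /= ?(g0, g1, g3, gx, gb) ?addn1 //; lia.
set g' := upd g _ _.
have [g'0 g'2] : g' 0 = N /\ g' (N + 2) = size (P ++ x :: R).
  by split; rewrite /g' /g !upd_other //; lia.
by have := @runs_incr V 2 g'; rewrite g'0 g'2; apply; lia.
Qed.

Definition star_solver p a k := forall X : fcmj, exists t m,
  [/\ exec p (load (fcmj_code X)) t m, t <= a * code_size (fcmj_code X) ^ k
    & fcmj_solution X (output m)].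

(** The three summands bound the costs of the bookkeeping, of the final [Skip] of
    [fill], and of the relocated solver. *)
Definition body_time V N a k x :=
  (fill_size star_exprs + 200) * bitlen V + 1
  + slowdown N * (a * code_size (star_code x) ^ k).

(** Both outcomes are correct: a split needs no optimality, since the
    program checks that the candidate divides x; that x is prime otherwise is
    [star_optimal_split]. *)
Lemma runs_body p a k V N i P x R h : star_solver p a k ->
  1 < x <= N -> 20 * N <= V -> N * N <= V ->
  i.+1 < N -> (size (P ++ x :: R)).+1 < N -> layout N i i P (x :: R) h ->
  exists h' P' R', [/\ runs_to (body p) h (body_time V N a k x) h',
    layout N i.+1 i.+1 P' R' h' &
    [/\ P' = rcons P x, R' = R & prime x]
    \/ exists d e, [/\ P' = P, R' = d :: rcons R e, 1 < d, 1 < e & d * e = x]].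
Proof.
move=> solver /andP[x_gt1 x_le] le_V1 le_V2 lt_iN lt_sz L.
have [h1 [run1 L1 em1]] := runs_load_star x_gt1 x_le le_V1 le_V2 L.
have [t [m [ex_p le_t [q opt out]]]] := solver (star x_gt1).
rewrite fcmj_code_star in ex_p le_t.
have [h2 [run2 em2 off2]] := runs_reloc ex_p (layout_frame L1) em1.
have {L1} L2 : layout N i i.+1 P (x :: R) h2.
  exact: layout_unchanged (leqnn _) L1 off2.
have b_eq : h2 (cell N i 2) = q probe.
  rewrite em2; move: out; rewrite enum_star_components /output /=.
  by case: (m 0) => [|[|[|n]]] //= [].
have [_ b_x _] := star_optimal opt.
have split_prime := star_optimal_split opt.
rewrite -b_eq in b_x split_prime; set b := h2 _ in b_x split_prime b_eq *.
have [[h0 h1' i_gt i_lt] hl hi _ sz _] := L2; have hx := layout_cur L2.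
have hb : h2 (N * (2 + 1) + i) = b by [].
have szE : size (P ++ x :: R) = size P + (size R).+1 by rewrite size_cat.
have eval_sp : (eval h2 splits != 0) = (1 < x - b) && (x - b %| x).
  by rewrite /= !(h0, h1', hi, hx, hb) eval_splits.
have sp_le : (x - b - 1) * (1 - x %% (x - b)) <= x.
  by apply: leq_trans (leq_mul (leqnn _) (leq_subr _ _)) _; lia.
have bd_sp : bounded V h2 splits.
  rewrite /= !(h0, h1', hi, hx, hb); have := leq_mod x (x - b).
  by move: sp_le; move: (_ * _ in X in X -> _) => w; lia.
have [h3 [P' [R' [run3 L3 res]]]] : exists h' P' R',
    [/\ runs_to (If splits split_cmd (incr 3)) h2
           (expr_size splits * bitlen V + 100 * bitlen V) h',
      layout N i i.+1 P' R' h' &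
      [/\ P' = rcons P x, R' = R & prime x]
      \/ exists d e, [/\ P' = P, R' = d :: rcons R e, 1 < d, 1 < e & d * e = x]].
  case sp: ((1 < x - b) && (x - b %| x)); rewrite sp in eval_sp split_prime.
    have [h3 run3 L3] := runs_split_cmd (ltnSn i) b_x x_le le_V1 lt_sz L2 erefl.
    exists h3, P, (x - b :: rcons R (x %/ (x - b))); split=> //.
      by apply: runs_if => //; rewrite eval_sp.
    right; exists (x - b), (x %/ (x - b)).
    have /andP[d_gt1 d_dvd] := sp; split=> //; last by rewrite mulnC divnK.
    by rewrite ltn_divRL // mul1n; lia.
  exists (upd h2 (N + 3) (size P).+1), (rcons P x), R; split.
  - apply: runs_if => //; rewrite eval_sp.
    apply: (@runs_le _ _ (11 * bitlen V)); first by rewrite leq_mul2r orbT.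
    by have := @runs_incr V 3 h2; rewrite h0 hi; apply; lia.
  - exact: layout_next.
  - by left; split=> //; apply: split_prime.
exists (upd h3 (N + 1) i.+1), P', R'; split=> //; last exact: layout_incr_offset.
apply: (@runs_le _ _ ((fill_size star_exprs * bitlen V + 1) + (slowdown N * t
   + ((expr_size splits * bitlen V + 100 * bitlen V) + 11 * bitlen V)))).
  have := leq_mul (leqnn (slowdown N)) le_t.
  by rewrite /body_time mulnDl -[expr_size splits]/58; lia.
apply: runs_seq run1 (runs_seq run2 (runs_seq run3 _)).
have [[h30 h31 _ _] _ _ _ _ _] := L3.
by have := @runs_incr V 1 h3; rewrite h30 h31; apply; lia.
Qed.

(** * The factorization program *)

Lemma exp2_size_le_prod s : all (ltn 1) s -> 2 ^ size s <= \prod_(x <- s) x.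
Proof.
elim: s => [|x s IHs] /=; first by rewrite big_nil.
by case/andP=> x_gt1 /IHs le_s; rewrite big_cons expnS leq_mul.
Qed.

Definition factor_loop p := While (Bin Defs.Sub len idx) (body p).

(** Each iteration increases size P + size (P ++ R) by one, and both sizes are at
    most l because a list of integers greater than 1 with product M has at most
    log2 M entries.  The offset 3 + size P + size (P ++ R) thus stays below
    N. *)
Lemma runs_factor_loop p a k M T : star_solver p a k -> 1 < M ->
  let N := 16 * M in let V := N * N in let l := trunc_log 2 M in
  (forall x, x <= M -> 20 * bitlen V + body_time V N a k x <= T) ->
  forall n P R h, let i := 3 + size P + size (P ++ R) in
  layout N i i P R h -> all prime P -> all (ltn 1) R ->
  \prod_(x <- P ++ R) x = M -> 2 * l <= n + size P + size (P ++ R) ->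
  exists h' i' P', [/\ runs_to (factor_loop p) h (n.+1 * T) h',
    layout N i' i' P' [::] h', all prime P' & \prod_(x <- P') x = M].
Proof.
move=> solver M_gt1 N V l le_T.
have le_V : 20 * N <= V by rewrite leq_mul2r /N; lia.
have VT : 11 * bitlen V <= T by have := le_T 0 isT; lia.
have bound_size P R : all prime P -> all (ltn 1) R ->
    \prod_(x <- P ++ R) x = M -> size (P ++ R) <= l.
  move=> prP gtR prodM; apply: trunc_log_max => //; rewrite -prodM.
  apply: exp2_size_le_prod; rewrite all_cat gtR andbT.
  by apply: sub_all prP => x; apply: prime_gt1.
have lM : l < M.
  by apply: leq_trans (ltn_expl l (isT : 1 < 2)) _; apply: trunc_logP; lia.
have test P R i h : layout N i i P R h ->
    eval h (Bin Defs.Sub len idx) = size R /\ bounded V h (Bin Defs.Sub len idx).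
  case=> [[h0 _ _ _] hl hi _ sz _]; rewrite /= !(h0, hl, hi) size_cat addKn.
  by rewrite size_cat in sz; split=> //; lia.
elim=> [|n IHn] P [|x R] h i L prP gtR prodM le_l;
  have le_sz := bound_size _ _ prP gtR prodM; have [ev bd] := test _ _ _ _ L.
- exists h, i, P; rewrite cats0 in prodM; split=> //.
  apply: (@runs_le _ _ (11 * bitlen V)); last exact: runs_while_false.
  by rewrite mul1n.
- by move: le_l le_sz; rewrite size_cat /=; lia.
- exists h, i, P; rewrite cats0 in prodM; split=> //.
  apply: (@runs_le _ _ (11 * bitlen V)); last exact: runs_while_false.
  by apply: leq_trans VT _; rewrite leq_pmull.
have nE : size (P ++ x :: R) = size P + (size R).+1 by rewrite size_cat.
have x_le : x <= M.
  by apply: dvdn_leq; [lia | rewrite -prodM big_cat big_cons /= mulnCA dvdn_mulr].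
have /= /andP[x_gt1 gtR'] := gtR.
have [|||||h' [P' [R' [run L' res]]]] := @runs_body p a k V N i P x R h solver _ le_V.
- by rewrite x_gt1 /N; lia.
- by [].
- by rewrite /i /N; lia.
- by rewrite /N; lia.
- exact: L.
have [] : [/\ i.+1 = 3 + size P' + size (P' ++ R'), all prime P',
              all (ltn 1) R' & \prod_(y <- P' ++ R') y = M].
  case: res => [[-> -> x_pr] | [d [e [-> -> d_gt1 e_gt1 de]]]].
    split; rewrite ?cat_rcons // ?all_rcons ?x_pr //.
    by rewrite size_rcons /i; lia.
  split=> //; first by rewrite /i !size_cat /= size_rcons; lia.
    by rewrite /= all_rcons; apply/and3P.
  rewrite -prodM !big_cat !big_cons -cats1 big_cat big_seq1 /= -de.
  by rewrite -!mulnA [e * _]mulnC.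
move=> iE prP' gtR'' prodM'; rewrite iE in L'.
have [|h'' [i' [P'' [run' L'' prP'' prodM'']]]] := IHn _ _ _ L' prP' gtR'' prodM'.
  by rewrite /i in iE; lia.
exists h'', i', P''; split=> //.
have le_Tx := le_T x x_le.
apply: (@runs_le _ _ (11 * bitlen V + body_time V N a k x + n.+1 * T)).
  by rewrite [n.+2 * T]mulSn leq_add2r; lia.
by apply: runs_while_true run run'; rewrite ?ev.
Qed.

(** The output fills an initial segment of unbounded length, in which no variable
    survives except in cell 0.  Cell 0 therefore holds the stride, through which
    all variables are reached, until the last store replaces it by the length of
    the list; the entries have been in their final places all along.  The
    counter of primes at N + 3 starts at 0 as the cell is initially empty. *)
Definition factor_prog p :=
  Seq (Store (Const 0) (Bin Mul (Const 16) (Read (Const 1))))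
    (Seq (Store (var_addr 1) (Const 4))
      (Seq (Store (var_addr 2) (Const 1))
        (Seq (factor_loop p) (Store (Const 0) len)))).

Lemma runs_factor_prog p a k M T : star_solver p a k -> 1 < M ->
  let N := 16 * M in let V := N * N in let l := trunc_log 2 M in
  (forall x, x <= M -> 20 * bitlen V + body_time V N a k x <= T) ->
  exists m, [/\ runs_to (factor_prog p) (load [:: M])
                  ((2 * l).+1 * T + 30 * bitlen V) m,
    all prime (output m) & \prod_(x <- output m) x = M].
Proof.
move=> solver M_gt1 N V l le_T.
have le_V : 20 * N <= V by rewrite leq_mul2r /N; lia.
set m0 := load [:: M]; set m1 := upd m0 0 N.
set m2 := upd m1 (N + 1) 4; set m3 := upd m2 (N + 2) 1.
have L : layout N 4 4 [::] [:: M] m3.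
  have zero b : 2 <= b -> m0 b = 0 by case: b => [|[|b]] //= _; rewrite /m0 /load /= nth_nil.
  split=> //.
  - by split; rewrite /m3 /m2 /m1 /upd; do ?case: eqP; rewrite /N; lia.
  - by rewrite /m3 upd_same.
  - by rewrite /m3 /m2 /m1 !upd_other ?zero //; rewrite /N; lia.
  - by case=> // _; rewrite /m3 /m2 /m1 !upd_other //; rewrite /N; lia.
  - by rewrite /N /=; lia.
  - move=> j c j_bd; have := cell_ge N j c => ge_N.
    rewrite /m3 upd_other; last by apply: cell_neq_var; lia.
    rewrite /m2 upd_other; last by apply: cell_neq_var; lia.
    by rewrite /m1 upd_other ?zero //; rewrite /N in ge_N *; lia.
have [|||| h [i [P [run Lh prP prodM]]]] :=
  @runs_factor_loop p a k M T solver M_gt1 le_T (2 * l) [::] [:: M] m3 L.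
- by [].
- by rewrite /= M_gt1.
- by rewrite big_seq1.
- by rewrite addn0 leq_addr.
have [[h0 _ _ _] hl _ hL sz _] := Lh; rewrite cats0 in hl hL sz.
have outE : output (upd h 0 (size P)) = P.
  apply: (@eq_from_nth _ 0); rewrite /output upd_same size_mkseq // => j lt_j.
  by rewrite nth_mkseq // upd_other // -addn1 hL.
exists (upd h 0 (size P)); rewrite outE; split=> //.
apply: (@runs_le _ _ (5 * bitlen V + (5 * bitlen V + (5 * bitlen V
  + ((2 * l).+1 * T + 6 * bitlen V))))); first lia.
apply: (@runs_seq _ _ _ m1).
  have m01 : m0 1 = M by [].
  by apply: (@runs_store V); rewrite /= ?m01 //; move: le_V; rewrite /N; lia.
apply: (@runs_seq _ _ _ m2).
  by apply: (@runs_store V); rewrite /= ?[m1 0]upd_same //; lia.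
have m20 : m2 0 = N by rewrite /m2 upd_other ?[m1 0]upd_same // /N; lia.
apply: (@runs_seq _ _ _ m3).
  by apply: (@runs_store V); rewrite /= ?m20 //; lia.
by apply: runs_seq run _; apply: (@runs_store V); rewrite //= ?h0 ?hl //; lia.
Qed.

Lemma code_size_star x M : x <= M -> 1 < M -> code_size (star_code x) <= 24 * bitlen M.
Proof.
move=> x_le M_gt1; rewrite /code_size /star_code !big_cons big_nil.
have B_x := leq_bitlen x_le; have B_xx := bitlenM x x.
have B_x3 : bitlen (1 + (x - 3)) <= bitlen M by apply: leq_bitlen; lia.
have B_gt0 := bitlen_gt0 M.
have [b0 b1 b2 b3] : [/\ bitlen 0 = 1, bitlen 1 = 1, bitlen 2 = 2 & bitlen 3 = 2] by [].
by rewrite b0 b1 b2 b3; lia.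
Qed.

Theorem theorem2p1 :
  poly_time_solvable fcmj_code fcmj_solution ->
  poly_time_solvable composite_code prime_factorization.
Proof.
case=> p [a [k solver]].
pose K := fill_size star_exprs + 300.
pose C := 10 * K + 300 * (a * 24 ^ k).
exists (factor_prog p), (2 * C + 300), (k + 2) => -[M M_comp].
have M_gt1 : 1 < M by case/andP: M_comp.
have B_gt1 : 1 < bitlen M by rewrite /bitlen ltnS trunc_log_gt0.
have := bitlenM 16 M; rewrite -[bitlen 16]/5.
have := bitlenM (16 * M) (16 * M); set N := 16 * M; set V := N * N.
set B := bitlen M in B_gt1 * => le_V le_N.
(* With B the bit length of M, an iteration takes time O(B^(k + 1)) and there
   are fewer than 2 B of them. *)
have [|m [[t ex le_t] pr_out prod_out]] :=
    @runs_factor_prog p a k M (C * B ^ k.+1) solver M_gt1.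
  move=> x x_le; rewrite -/N -/V /body_time.
  have le_code : code_size (star_code x) ^ k <= 24 ^ k * B ^ k.
    rewrite -expnMn; case: (k) => // k'.
    by rewrite leq_exp2r // code_size_star.
  have le_slow : slowdown N <= 300 * B by rewrite /slowdown; lia.
  have le_B : B <= B ^ k.+1 by rewrite expnS leq_pmulr // expn_gt0; lia.
  have le_call : slowdown N * (a * code_size (star_code x) ^ k)
      <= 300 * (a * 24 ^ k) * B ^ k.+1.
    apply: leq_trans (leq_mul le_slow (leq_mul (leqnn a) le_code)) _.
    by rewrite expnS; apply: eq_leq; ring.
  have le_rest : 20 * bitlen V + ((fill_size star_exprs + 200) * bitlen V + 1)
      <= 10 * K * B ^ k.+1.
    by apply: leq_trans (leq_mul (leqnn (10 * K)) le_B); rewrite /K; nia.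
  by rewrite /C mulnDl; lia.
exists t, m; split=> //; apply: leq_trans le_t _.
rewrite /code_size big_seq1 -/B -/N -/V -[(2 * _).+1]/((2 * B.-1).+1).
have -> : k + 2 = k.+2 by rewrite addn2.
have le_B : B <= B ^ k.+2 by rewrite expnS leq_pmulr // expn_gt0; lia.
have : (2 * B.-1).+1 * (C * B ^ k.+1) <= 2 * C * B ^ k.+2.
  apply: (@leq_trans (2 * B * (C * B ^ k.+1))); first by rewrite leq_mul2r; lia.
  by rewrite [B ^ k.+2]expnS; apply: eq_leq; ring.
by rewrite mulnDl; lia.
Qed.
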